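(* An oracle that solves the generalized HomSP for $(S_A,S_B)$ and the HomSP for $S_B$ is sufficient to break key establishment Protocol 2.
   Context: Let $L$ be a set with non-empty families $O_A,O_B$ of binary operations such that $x*_\alpha(y*_\beta z)=(x*_\alpha y)*_\beta(x*_\alpha z)$ and $x*_\beta(y*_\alpha z)=(x*_\beta y)*_\alpha(x*_\beta z)$ for all $x,y,z\in L$, $*_\alpha\in O_A$, $*_\beta\in O_B$. For a family $O$ of operations, $\langle y_1,\ldots,y_k\rangle_O$ is the smallest subset of $L$ containing $y_1,\ldots,y_k$ and closed under all operations in $O$. For $x=(x_1,\ldots,x_k)\in L^k$ and a vector of operations $o=( *_1,\ldots,*_k)$ put $\phi_{(x,o)}(y)=x_k*_k(x_{k-1}*_{k-1}\cdots(x_2*_2(x_1*_1y))\cdots)$. Protocol 2: public elements $s_1,\ldots,s_m,t_1,\ldots,t_n\in L$ are given, $S_A=\langle s_1,\ldots,s_m\rangle_{O_A}$, $S_B=\langle t_1,\ldots,t_n\rangle_{O_B}$. Alice's secret key is $(a_0,a,o_A)\in S_A\times L^{k_A}\times O_A^{k_A}$, Bob's is $(b,o_B)\in S_B^{k_B}\times O_B^{k_B}$ (with secret $k_A,k_B\ge1$). Put $\alpha=\phi_{(a,o_A)}$, $\beta=\phi_{(b,o_B)}$. Alice publishes $t_i'=\alpha(t_i)$ ($i\le n$) and $p_0=\alpha(a_0)$; Bob publishes $s_j'=\beta(s_j)$ ($j\le m$). The shared key is $K=\alpha(\beta(a_0))$. Breaking the protocol means finding $K$ from the public data $s_j,s_j',t_i,t_i',p_0$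 (the attacker can evaluate the operations in $O_A\cup O_B$). Generalized HomSP (Homomorphism Search Problem) for $(S_A,S_B)$: given pairs $(s_1,s_1'),\ldots,(s_m,s_m')\in L^2$ for which there are unknown $k_B$, $b$ and $o_B\in O_B^{k_B}$ with $s_i'=\phi_{(b,o_B)}(s_i)$ for all $i\le m$, find $k_B'\in\mathbb{N}$, $b'\in S_B^{k_B'}$ and $o_B'\in O_B^{k_B'}$, defining a magma homomorphism $\phi_{(b',o_B')}:S_A\to(L,O_A)$, such that $\phi_{(b',o_B')}(s_i)=s_i'$ for all $i\le m$. HomSP for $S_B$: given pairs $(t_1,t_1'),\ldots,(t_n,t_n')\in L^2$ for which there are unknown $k_A$, $a\in L^{k_A}$ and $o_A\in O_A^{k_A}$ with $t_i'=\phi_{(a,o_A)}(t_i)$ for all $i\le n$, find $k_A'\in\mathbb{N}$, $a'\in L^{k_A'}$ and $o_A'\in O_A^{k_A'}$, defining a magma homomorphism $\phi_{(a',o_A')}:S_B\to(L,O_B)$, such that $\phi_{(a',o_A')}(t_i)=t_i'$ for all $i\le n$. *)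

(* Defs.v *)
From mathcomp Require Import all_boot.
From mathcomp Require Import classical_sets.

Set Implicit Arguments.
Unset Strict Implicit.
Unset Printing Implicit Defensive.

Local Open Scope classical_set_scope.

(* A family of binary operations on L is a map I -> L -> L -> L. *)

Definition mutually_distributive (L IA IB : Type)
    (opA : IA -> L -> L -> L) (opB : IB -> L -> L -> L) : Prop :=
  forall (i : IA) (j : IB) (x y z : L),
    opA i x (opB j y z) = opB j (opA i x y) (opA i x z) /\
    opB j x (opA i y z) = opA i (opB j x y) (opB j x z).

Definition closed_under (L I : Type) (op : I -> L -> L -> L) : set (set L) :=
  [set S | forall i x y, S x -> S y -> S (op i x y)].

Definition generated (L I : Type) (op : I -> L -> L -> L) (k : nat)
    (y : k.-tuple L) : set L :=
  smallest (closed_under op) (range (tnth y)).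

Definition magma_hom_on (L I : Type) (op : I -> L -> L -> L) (S : set L)
    (f : L -> L) : Prop :=
  forall i x y, S x -> S y -> f (op i x y) = op i (f x) (f y).

(* x_1 is applied first: phi op x o y = x_k *_k (... (x_1 *_1 y)). *)
Definition phi (L I : Type) (op : I -> L -> L -> L) (k : nat)
    (x : k.-tuple L) (o : k.-tuple I) (y : L) : L :=
  foldl (fun z p => op p.2 p.1 z) y (zip x o).

Record hom_key (L I : Type) := HomKey {
  key_len : nat;
  key_elts : key_len.-tuple L;
  key_ops : key_len.-tuple I }.

Definition key_map (L I : Type) (op : I -> L -> L -> L) (h : hom_key L I) :
  L -> L := phi op (key_elts h) (key_ops h).

Section HomSP.

(* Find a key over the operations [opK] with elements in [D] that defines a
   magma homomorphism from the [opS]-magma generated by [g].  The generalized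
   problem for (S_A, S_B) has opS := O_A, opK := O_B, D := S_B; the problem
   for S_B has opS := O_B, opK := O_A, D := L. *)
Variables (L IS IK : Type) (opS : IS -> L -> L -> L) (opK : IK -> L -> L -> L).
Variables (k : nat) (g : k.-tuple L) (D : set L).

Definition HomSP_instance (pairs : k.-tuple (L * L)) : Prop :=
  (forall i, (tnth pairs i).1 = tnth g i) /\
  exists h : hom_key L IK,
    [/\ (0 < key_len h)%N, (forall l, D (tnth (key_elts h) l)) &
        forall i, (tnth pairs i).2 = key_map opK h (tnth pairs i).1].

Definition HomSP_solution (pairs : k.-tuple (L * L)) (h : hom_key L IK) : Prop :=
  [/\ (forall l, D (tnth (key_elts h) l)),
      magma_hom_on opS (generated opS g) (key_map opK h) &
      forall i, key_map opK h (tnth pairs i).1 = (tnth pairs i).2].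

(* Nothing is required of the oracle outside the promise. *)
Definition HomSP_oracle (oracle : k.-tuple (L * L) -> hom_key L IK) : Prop :=
  forall pairs, HomSP_instance pairs -> HomSP_solution pairs (oracle pairs).

End HomSP.

Definition generalized_HomSP_oracle (L IA IB : Type)
    (opA : IA -> L -> L -> L) (opB : IB -> L -> L -> L) (m n : nat)
    (s : m.-tuple L) (t : n.-tuple L)
    (oracle : m.-tuple (L * L) -> hom_key L IB) : Prop :=
  HomSP_oracle opA opB s (generated opB t) oracle.

Definition HomSP_B_oracle (L IA IB : Type)
    (opA : IA -> L -> L -> L) (opB : IB -> L -> L -> L) (n : nat)
    (t : n.-tuple L) (oracle : n.-tuple (L * L) -> hom_key L IA) : Prop :=
  HomSP_oracle opB opA t setT oracle.

Section Protocol.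

Variables (L IA IB : Type).
Variables (opA : IA -> L -> L -> L) (opB : IB -> L -> L -> L).
Variables (m n : nat) (s : m.-tuple L) (t : n.-tuple L).

Definition alice_key (a0 : L) (a : hom_key L IA) : Prop :=
  generated opA s a0 /\ (0 < key_len a)%N.

Definition bob_key (b : hom_key L IB) : Prop :=
  (0 < key_len b)%N /\ forall l, generated opB t (tnth (key_elts b) l).

Definition shared_key (a0 : L) (a : hom_key L IA) (b : hom_key L IB) : L :=
  key_map opA a (key_map opB b a0).

End Protocol.

Inductive public_name (m n : nat) : Type :=
| Pub_s of 'I_m
| Pub_s' of 'I_m
| Pub_t of 'I_n
| Pub_t' of 'I_n
| Pub_p0.

Arguments Pub_p0 {m n}.

Definition public_data (L IA IB : Type)
    (opA : IA -> L -> L -> L) (opB : IB -> L -> L -> L) (m n : nat)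
    (s : m.-tuple L) (t : n.-tuple L)
    (a0 : L) (a : hom_key L IA) (b : hom_key L IB) (v : public_name m n) : L :=
  match v with
  | Pub_s j => tnth s j
  | Pub_s' j => key_map opB b (tnth s j)
  | Pub_t i => tnth t i
  | Pub_t' i => key_map opA a (tnth t i)
  | Pub_p0 => key_map opA a a0
  end.

(* Attackers are syntactic, generic (black-box) algorithms: were an attacker an
   arbitrary function of the public data, the claim would hold without any
   oracle, because the public data determine the shared key.  A generic
   algorithm holds elements of L only under names from V, never sees them, and
   gets new ones only by evaluating operations or by querying an oracle; the
   length and the operations of an oracle's answer are available to it in the
   clear, and the elements of the answer become new names. *)
Section Attacker.

Variables (IA IB : Type).

Inductive expr (V : Type) : Type :=
| Name of V
| EvalA of IA & expr V & expr V
| EvalB of IB & expr V & expr V.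

Inductive attacker (m n : nat) : Type -> Type :=
| Output V of expr V : attacker m n V
| AskGeneralizedHomSP V of m.-tuple (expr V * expr V) &
    (forall k, k.-tuple IB -> attacker m n (V + 'I_k)) : attacker m n V
| AskHomSP_B V of n.-tuple (expr V * expr V) &
    (forall k, k.-tuple IA -> attacker m n (V + 'I_k)) : attacker m n V.

Variables (L : Type) (opA : IA -> L -> L -> L) (opB : IB -> L -> L -> L).

Fixpoint eval (V : Type) (env : V -> L) (e : expr V) : L :=
  match e with
  | Name v => env v
  | EvalA i e1 e2 => opA i (eval env e1) (eval env e2)
  | EvalB j e1 e2 => opB j (eval env e1) (eval env e2)
  end.

Definition eval_pair (V : Type) (env : V -> L) (p : expr V * expr V) : L * L :=
  (eval env p.1, eval env p.2).

Definition extend (V : Type) (env : V -> L) (k : nat) (x : k.-tuple L)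
    (v : V + 'I_k) : L :=
  match v with inl w => env w | inr l => tnth x l end.

Variables (m n : nat).
Variables (gen_oracle : m.-tuple (L * L) -> hom_key L IB).
Variables (hom_oracle : n.-tuple (L * L) -> hom_key L IA).

Fixpoint run (V : Type) (P : attacker m n V) : (V -> L) -> L :=
  match P in attacker _ _ V return (V -> L) -> L with
  | Output _ e => fun env => eval env e
  | AskGeneralizedHomSP _ q next => fun env =>
      let h := gen_oracle (map_tuple (eval_pair env) q) in
      run (next (key_len h) (key_ops h)) (extend env (key_elts h))
  | AskHomSP_B _ q next => fun env =>
      let h := hom_oracle (map_tuple (eval_pair env) q) in
      run (next (key_len h) (key_ops h)) (extend env (key_elts h))
  end.

End Attacker.

Definition breaks_protocol (L IA IB : Type)
    (opA : IA -> L -> L -> L) (opB : IB -> L -> L -> L) (m n : nat)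
    (s : m.-tuple L) (t : n.-tuple L)
    (gen_oracle : m.-tuple (L * L) -> hom_key L IB)
    (hom_oracle : n.-tuple (L * L) -> hom_key L IA)
    (P : attacker IA IB m n (public_name m n)) : Prop :=
  forall (a0 : L) (a : hom_key L IA) (b : hom_key L IB),
    alice_key opA s a0 a -> bob_key opB t b ->
    run opA opB gen_oracle hom_oracle P (public_data opA opB s t a0 a b) =
      shared_key opA opB a0 a b.

(* Main.v *)
Require Import Defs.
From mathcomp Require Import all_boot.
From mathcomp Require Import classical_sets.

(** The homomorphism [beta'] returned by the first oracle agrees with Bob's
    [beta] on [S_A], since both agree on the generators, and likewise the
    homomorphism [alpha'] returned by the second agrees with Alice's [alpha] on
    [S_B].  If [b'_1, ..., b'_k] are the elements defining [beta'], then, as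
    [alpha] is a homomorphism for [O_B],
    [K = alpha (beta' a_0)
       = alpha b'_k * (... (alpha b'_1 * alpha a_0))
       = alpha' b'_k * (... (alpha' b'_1 * p_0))],
    because the [b'_l] lie in [S_B].  The last expression is computable by the
    attacker. *)

Set Implicit Arguments.
Unset Strict Implicit.
Unset Printing Implicit Defensive.

(** Two carrier types are allowed because this serves twice: for [eval], from expressions to [L],
    and for Alice's map, from [L] to itself. *)
Lemma phi_morph (L L' I : Type) (op : I -> L -> L -> L)
    (op' : I -> L' -> L' -> L') (f : L -> L') (k : nat) (x : k.-tuple L)
    (o : k.-tuple I) (y : L) :
  (forall i u v, f (op i u v) = op' i (f u) (f v)) ->
  f (phi op x o y) = phi op' (map_tuple f x) o (f y).
Proof.
move=> fM; rewrite /phi /=.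
elim: (tval x) (tval o) y => [|u xs IHx] [|i os] y //=.
by rewrite IHx fM.
Qed.

Lemma phi_distr (L I J : Type) (op : I -> L -> L -> L) (op2 : J -> L -> L -> L)
    (k : nat) (x : k.-tuple L) (o : k.-tuple I) (j : J) (y z : L) :
  (forall i u v w, op i u (op2 j v w) = op2 j (op i u v) (op i u w)) ->
  phi op x o (op2 j y z) = op2 j (phi op x o y) (phi op x o z).
Proof.
move=> opD; rewrite /phi.
by elim: (zip x o) y z => [|p s IHs] y z //=; rewrite opD IHs.
Qed.

Lemma magma_hom_generated_ext (L I : Type) (op : I -> L -> L -> L) (k : nat)
    (g : k.-tuple L) (f1 f2 : L -> L) :
  magma_hom_on op (generated op g) f1 -> magma_hom_on op (generated op g) f2 ->
  (forall i, f1 (tnth g i) = f2 (tnth g i)) ->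
  forall x, generated op g x -> f1 x = f2 x.
Proof.
move=> f1M f2M eqg x gx.
have genM i u v : generated op g u -> generated op g v ->
    generated op g (op i u v).
  by move=> gu gv S SP; apply: SP.1; [apply: gu|apply: gv].
suff [] : generated op g x /\ f1 x = f2 x by [].
(* Minimality of the generated magma is applied to the set where [f1] and [f2] agree. Membership is
   carried along, since the maps are known to be multiplicative only there. *)
apply: (gx (fun u => generated op g u /\ f1 u = f2 u)); split.
  move=> i u v [gu eu] [gv ev]; split; first exact: genM.
  by rewrite f1M // f2M // eu ev.
by move=> _ [i _ <-]; split=> // S [_ Sg]; apply: Sg; exists i.
Qed.

(** Here [h] is the secret key, a homomorphism on all of [L] by distributivity. *)
Lemma HomSP_solution_ext (L IS IK : Type) (opS : IS -> L -> L -> L)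
    (opK : IK -> L -> L -> L) (k : nat) (g : k.-tuple L) (D : set L)
    (pairs : k.-tuple (L * L)) (h h' : hom_key L IK) :
  (forall i j x y z, opK i x (opS j y z) = opS j (opK i x y) (opK i x z)) ->
  (forall i, tnth pairs i = (tnth g i, key_map opK h (tnth g i))) ->
  HomSP_solution opS opK g D pairs h' ->
  forall x, generated opS g x -> key_map opK h' x = key_map opK h x.
Proof.
move=> opD pairsE [_ h'M h'E]; apply: magma_hom_generated_ext => //.
  by move=> j x y _ _; apply: phi_distr => i u v w; apply: opD.
by move=> i; have := h'E i; rewrite pairsE.
Qed.

(** Here [phi] runs on syntax, with constructors as operations. Names [inr _] belong to the second
    answer, [inl (inr _)] to the first, [inl (inl _)] to the public data. *)
Definition recovered_key (IA IB V : Type) (k1 k2 : nat) (o1 : k1.-tuple IB)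
    (o2 : k2.-tuple IA) (p0 : V) : expr IA IB (V + 'I_k1 + 'I_k2) :=
  phi (@EvalB IA IB _)
    [tuple phi (@EvalA IA IB _) [tuple Name IA IB (inr l2) | l2 < k2] o2
             (Name IA IB (inl (inr l1))) | l1 < k1]
    o1 (Name IA IB (inl (inl p0))).

Definition oracle_attacker (IA IB : Type) (m n : nat) :
    attacker IA IB m n (public_name m n) :=
  AskGeneralizedHomSP
    [tuple (Name IA IB (Pub_s n j), Name IA IB (Pub_s' n j)) | j < m]
    (fun k1 o1 => AskHomSP_B
      [tuple (Name IA IB (inl (Pub_t m i)), Name IA IB (inl (Pub_t' m i)))
        | i < n]
      (fun k2 o2 => Output m n (recovered_key o1 o2 Pub_p0))).

Lemma eval_recovered_key (IA IB V L : Type) (opA : IA -> L -> L -> L)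
    (opB : IB -> L -> L -> L) (env : V -> L) (hB : hom_key L IB)
    (hA : hom_key L IA) (p0 : V) :
  eval opA opB (extend (extend env (key_elts hB)) (key_elts hA))
    (recovered_key (key_ops hB) (key_ops hA) p0) =
  phi opB (map_tuple (key_map opA hA) (key_elts hB)) (key_ops hB) (env p0).
Proof.
rewrite /recovered_key (phi_morph (op' := opB)) //=; congr (phi _ _ _ _).
apply: eq_from_tnth => l; rewrite !tnth_map tnth_ord_tuple.
rewrite (phi_morph (op' := opA)) //=; congr (phi _ _ _ _).
by apply: eq_from_tnth => l2; rewrite !tnth_map tnth_ord_tuple.
Qed.

Theorem proposition4p4 (IA IB : Type) (hIA : inhabited IA) (hIB : inhabited IB)
    (m n : nat) :
  exists P : attacker IA IB m n (public_name m n),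
    forall (L : Type) (opA : IA -> L -> L -> L) (opB : IB -> L -> L -> L)
      (s : m.-tuple L) (t : n.-tuple L)
      (gen_oracle : m.-tuple (L * L) -> hom_key L IB)
      (hom_oracle : n.-tuple (L * L) -> hom_key L IA),
      mutually_distributive opA opB ->
      generalized_HomSP_oracle opA opB s t gen_oracle ->
      HomSP_B_oracle opA opB t hom_oracle ->
      breaks_protocol opA opB s t gen_oracle hom_oracle P.
Proof.
exists (oracle_attacker IA IB m n).
move=> L opA opB s t gen_oracle hom_oracle distr genP homP a0 a b.
move=> [a0_gen a_gt0] [b_gt0 b_gen].
have opAD i j x y z := (distr i j x y z).1.
have opBD j i x y z := (distr i j x y z).2.
rewrite /= eval_recovered_key.
set qB := map_tuple _ _; set hB := gen_oracle qB.
set qA := map_tuple (eval_pair _ _ _) _; set hA := hom_oracle qA.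
have qBE j : tnth qB j = (tnth s j, key_map opB b (tnth s j)).
  by rewrite !tnth_map tnth_ord_tuple.
have qAE i : tnth qA i = (tnth t i, key_map opA a (tnth t i)).
  by rewrite !tnth_map tnth_ord_tuple.
(* Bob's own key, with elements in S_B, witnesses the promise. *)
have hBP : HomSP_solution opA opB s (generated opB t) qB hB.
  apply: genP; split=> [j|]; first by rewrite qBE.
  by exists b; split=> // j; rewrite qBE.
have hAP : HomSP_solution opB opA t setT qA hA.
  apply: homP; split=> [i|]; first by rewrite qAE.
  by exists a; split=> // i; rewrite qAE.
rewrite /shared_key -(HomSP_solution_ext opBD qBE hBP a0_gen).
(* Alice's map is pushed through the key [hB], reaching its elements and [a0]. *)
rewrite [RHS](phi_morph (op' := opB)); last first.
  by move=> j y z; apply: phi_distr => i u v w; apply: opAD.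
congr (phi _ _ _ _); apply: eq_from_tnth => l; rewrite !tnth_map.
(* [hBP] puts the elements of [hB] in S_B, where [hA] agrees with Alice's key. *)
by apply: (HomSP_solution_ext opAD qAE hAP); case: hBP.
Qed.
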